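(* Let $k$ be a positive integer and let $n = 8k-2$. Then there exist no normal sequences $NS(n)$.
   Context: For a finite sequence $A=(a_1,\dots,a_\ell)$ with entries in $\{+1,-1\}$, the non-periodic autocorrelation function is $N_A(i)=\sum_{j\in\mathbb{Z}} a_j a_{i+j}$, where $a_k=0$ if $k<1$ or $k>\ell$. For a positive integer $n$, base sequences $BS(n+1,n)$ are quadruples $(A;B;C;D)$ of sequences with entries in $\{+1,-1\}$, where $A,B$ have length $n+1$ and $C,D$ have length $n$, such that $N_A(i)+N_B(i)+N_C(i)+N_D(i)=0$ for all integers $i\ge 1$ (the value at $i=0$ is automatically $4n+2$). Normal sequences $NS(n)$ are quadruples $(A;B;C;D)\in BS(n+1,n)$, with $A=(a_1,\dots,a_{n+1})$ and $B=(b_1,\dots,b_{n+1})$, such that $b_i=a_i$ for $1\le i\le n$, $a_{n+1}=1$ and $b_{n+1}=-1$. *)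

(* Defs.v *)
From mathcomp Require Import all_boot all_order all_algebra.

Set Implicit Arguments.
Unset Strict Implicit.
Unset Printing Implicit Defensive.

Import Order.TTheory GRing.Theory Num.Theory.
Local Open Scope ring_scope.

Definition binary_seq (l : nat) (A : seq int) : Prop :=
  size A = l /\ all (fun x => (x == 1) || (x == -1)) A.

(* a_k with the 1-based indexing of A = (a_1, ..., a_l), extended by zero to
   every integer k outside [1, l]; [nth] is 0-based, whence the predecessor. *)
Definition entry (A : seq int) (k : int) : int :=
  if (1 <= k) && (k <= (size A)%:Z) then nth 0 A (`|k|%N).-1 else 0.

(* N_A(i) = \sum_(j in Z) a_j a_(i+j); the terms with j outside [1, l] vanish
   because a_j = 0, so the sum is taken over 1 <= j <= l. *)
Definition nacf (A : seq int) (i : int) : int :=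
  \sum_(1 <= j < (size A).+1) entry A j%:Z * entry A (i + j%:Z).

Definition base_sequences (n : nat) (A B C D : seq int) : Prop :=
  [/\ binary_seq n.+1 A /\ binary_seq n.+1 B,
      binary_seq n C /\ binary_seq n D &
      forall i : int, 1 <= i -> nacf A i + nacf B i + nacf C i + nacf D i = 0].

Definition normal_sequences (n : nat) (A B C D : seq int) : Prop :=
  [/\ base_sequences n A B C D,
      forall i : nat, (1 <= i <= n)%N -> entry B i%:Z = entry A i%:Z,
      entry A n.+1%:Z = 1 &
      entry B n.+1%:Z = -1].

(* Main.v *)
Require Import Defs.
From mathcomp Require Import all_boot all_order all_algebra.
From mathcomp Require Import zify ring.

(** Write A = (X, 1) and B = (X, -1).  The vanishing of the autocorrelations
    says that A(z)A(1/z) + B(z)B(1/z) + C(z)C(1/z) + D(z)D(1/z) is the constant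
    4n + 2, where a sequence is read as the generating polynomial of its
    entries.  At z = 1 and z = -1 this becomes, n being even,

      2 X(z)^2 + C(z)^2 + D(z)^2 = 4n = 32k - 8        (z = 1, -1).

    Let o and e be the sums of the entries of X at even and at odd positions.
    Each is a sum of n/2 = 4k - 1 signs, hence odd, so 4 divides one of
    X(1) = o + e and X(-1) = o - e.  For that z the term 2 X(z)^2 is a multiple
    of 32, which leaves C(z)^2 + D(z)^2 = 8 (4m - 1) for some m.  This is
    impossible: a sum of two squares has no such form
    ([sum_two_squares_neq]). *)

Set Implicit Arguments.
Unset Strict Implicit.
Unset Printing Implicit Defensive.

Import Order.TTheory GRing.Theory Num.Theory.
Local Open Scope ring_scope.

(** * Arithmetic *)

(** The squares are 0 mod 16, 4 mod 32 (when the root is 2 mod 4) and 1 mod 8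
    (when it is odd), so two of them add up to 8 mod 16 only as 4 + 4, which is
    8 and not -8 mod 32. *)
Lemma sum_two_squares_neq (c d m : int) : c ^+ 2 + d ^+ 2 <> 32 * m - 8.
Proof.
have half_pronic (q : int) : exists h, q * (q + 1) = 2 * h.
  have [h [->|->]] : exists h : int, q = 2 * h \/ q = 2 * h + 1.
  - by exists (q %/ 2)%Z; lia.
  - by exists (h * (2 * h + 1)); ring.
  - by exists ((2 * h + 1) * (h + 1)); ring.
have sqr_mod (x : int) :
    exists h : int, [\/ x ^+ 2 = 16 * h, x ^+ 2 = 32 * h + 4 | x ^+ 2 = 8 * h + 1].
  have [q xE] : exists q : int, x = 4 * q \/ x = 4 * q + 2 \/ x = 2 * q + 1.
    have [x_odd|x_even] : (x %% 2)%Z = 1 \/ (x %% 2)%Z = 0 by lia.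
    + by exists (x %/ 2)%Z; lia.
    + by exists (x %/ 4)%Z; lia.
  have [h hE] := half_pronic q.
  case: xE => [->|[->|->]].
  - by exists (q ^+ 2); apply: Or31; ring.
  - by exists h; apply: Or32; rewrite -[32]/(16 * 2 : int) -mulrA -hE; ring.
  - by exists h; apply: Or33; rewrite -[8]/(4 * 2 : int) -mulrA -hE; ring.
by have [g [->|->|->]] := sqr_mod c; have [h [->|->|->]] := sqr_mod d; lia.
Qed.

Lemma sum_signs_parity (I : Type) (r : seq I) (F : I -> int) :
  (forall i, F i = 1 \/ F i = -1) ->
  exists q : int, \sum_(i <- r) F i = (size r)%:Z + 2 * q.
Proof.
move=> signF; elim: r => [|i r [q IHr]]; first by exists 0; rewrite big_nil.
rewrite big_cons IHr /=.
by case: (signF i) => ->; [exists q|exists (q - 1)]; lia.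
Qed.

(** * Autocorrelation and the values of a sequence at 1 and -1 *)

(** A square of a sum, with the off-diagonal products grouped by the distance
    of their indices. *)
Lemma sqr_sum_by_shift (R : comNzRingType) (g : nat -> R) (m : nat) :
  (\sum_(j < m) g j) ^+ 2 =
  \sum_(j < m) g j ^+ 2
    + 2 * \sum_(1 <= i < m) \sum_(j < m - i) g j * g (i + j)%N.
Proof.
elim: m => [|m IHm]; first by rewrite !big_ord0 big_geq //; ring.
have new_products : \sum_(1 <= i < m.+1) g (m - i)%N * g m
                    = (\sum_(j < m) g j) * g m.
  rewrite big_add1 big_mkord mulr_suml (reindex_inj rev_ord_inj) /=.
  by apply: eq_bigr => j _; rewrite subnSK // subKn // ltnW.
have -> : \sum_(1 <= i < m.+1) \sum_(j < m.+1 - i) g j * g (i + j)%N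
    = \sum_(1 <= i < m) \sum_(j < m - i) g j * g (i + j)%N
      + (\sum_(j < m) g j) * g m.
  rewrite -new_products.
  transitivity (\sum_(1 <= i < m.+1)
      (\sum_(j < m - i) g j * g (i + j)%N + g (m - i)%N * g m)).
    apply: eq_big_nat => i /andP[_ lt_im].
    by rewrite subSn // big_ord_recr /= subnKC.
  rewrite big_split /=; congr (_ + _).
  case: m {IHm new_products} => [|m]; first by rewrite !big_geq.
  by rewrite big_nat_recr //= subnn big_ord0 addr0.
by rewrite !big_ord_recr /= sqrrD IHm; ring.
Qed.

Lemma entryS (A : seq int) (j : nat) : entry A j.+1%:Z = nth 0 A j.
Proof.
rewrite /entry /=; case: ifP => // nle_j.
by rewrite nth_default //; lia.
Qed.

(** The bound [m] is independent of the length of [A]: one bound above all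
    lengths serves a whole quadruple, and the bound [n] truncates the sequence
    A = (X, 1) of length n + 1 to X. *)
Definition value_at (e : int) (m : nat) (A : seq int) : int :=
  \sum_(j < m) e ^+ j * nth 0 A j.

Lemma sum_nth_shift (A : seq int) (m i : nat) : (size A <= m)%N ->
  \sum_(j < m - i) nth 0 A j * nth 0 A (i + j) = nacf A i%:Z.
Proof.
move=> le_Am.
rewrite /nacf big_add1 /= big_mkord.
(* Every product with i + j >= size A vanishes, so both ranges can be cut down
   to j < size A - i. *)
have cut N : (size A - i <= N)%N ->
    \sum_(j < N) nth 0 A j * nth 0 A (i + j)
    = \sum_(j < size A - i) nth 0 A j * nth 0 A (i + j).
  move=> le_N; rewrite -!(big_mkord xpredT (fun j => nth 0 A j * nth 0 A (i + j))).
  rewrite (big_cat_nat (leq0n _) le_N) /= [X in _ + X]big_nat_cond.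
  rewrite [X in _ + X]big1 ?addr0 // => j /andP[/andP[le_j _] _].
  by rewrite (nth_default 0 (n := i + j)) ?mulr0 // -leq_subLR.
rewrite cut ?leq_sub2r // -(cut (size A)) ?leq_subr //.
by apply: eq_bigr => j _; rewrite -PoszD addnS !entryS.
Qed.

(** As e = 1 or e = -1, each product e^j e^(i+j) equals e^i and can be taken out
    of the autocorrelation at shift i. *)
Lemma sqr_value_at (e : int) (m : nat) (A : seq int) :
  e ^+ 2 = 1 -> (size A <= m)%N ->
  value_at e m A ^+ 2 = \sum_(j < m) nth 0 A j ^+ 2
                        + 2 * \sum_(1 <= i < m) e ^+ i * nacf A i%:Z.
Proof.
move=> e2 le_Am.
have e_sqr j : e ^+ j * e ^+ j = 1 by rewrite -exprMn -expr2 e2 expr1n.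
rewrite /value_at (sqr_sum_by_shift (fun j => e ^+ j * nth 0 A j)).
congr (_ + 2 * _).
  by apply: eq_bigr => j _; rewrite exprMn expr2 e_sqr mul1r.
apply: eq_bigr => i _; rewrite -(sum_nth_shift i le_Am) mulr_sumr.
apply: eq_bigr => j _; rewrite exprD.
transitivity ((e ^+ j * e ^+ j) * (e ^+ i * (nth 0 A j * nth 0 A (i + j)))).
  by ring.
by rewrite e_sqr mul1r.
Qed.

Lemma nth_binary (l : nat) (A : seq int) (j : nat) :
  binary_seq l A -> (j < l)%N -> nth 0 A j = 1 \/ nth 0 A j = -1.
Proof.
move=> [<- /all_nthP binA] /(binA 0).
by case/orP => /eqP; [left|right].
Qed.

Lemma sum_sqr_binary (l m : nat) (A : seq int) :
  binary_seq l A -> (l <= m)%N -> \sum_(j < m) nth 0 A j ^+ 2 = l%:Z.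
Proof.
move=> binA le_lm; rewrite -(big_mkord xpredT (fun j => nth 0 A j ^+ 2)).
rewrite (big_cat_nat (leq0n _) le_lm) /= [X in _ + X]big_nat_cond.
rewrite [X in _ + X]big1 ?addr0 => [|j /andP[/andP[le_j _] _]]; last first.
  by case: binA => sizeA _; rewrite nth_default ?sizeA // expr0n.
rewrite (eq_big_nat _ _ (F2 := fun _ => 1)) => [|j /andP[_ lt_jl]].
  by rewrite sumr_const_nat subn0 natz.
by case: (nth_binary binA lt_jl) => ->; rewrite ?sqrrN expr1n.
Qed.

Lemma base_sequences_values (n : nat) (A B C D : seq int) (e : int) :
  e ^+ 2 = 1 -> base_sequences n A B C D ->
  value_at e n.+1 A ^+ 2 + value_at e n.+1 B ^+ 2
    + value_at e n.+1 C ^+ 2 + value_at e n.+1 D ^+ 2 = 4 * n%:Z + 2.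
Proof.
move=> e2 [[binA binB] [binC binD] sum0].
have sz l (S : seq int) : binary_seq l S -> (l <= n.+1)%N -> (size S <= n.+1)%N.
  by case=> ->.
rewrite !sqr_value_at ?(sz _ _ binA) ?(sz _ _ binB) ?(sz _ _ binC) ?(sz _ _ binD) //.
rewrite (sum_sqr_binary binA) // (sum_sqr_binary binB) //.
rewrite (sum_sqr_binary binC) // (sum_sqr_binary binD) //.
have : \sum_(1 <= i < n.+1) e ^+ i * nacf A i%:Z
       + \sum_(1 <= i < n.+1) e ^+ i * nacf B i%:Z
       + \sum_(1 <= i < n.+1) e ^+ i * nacf C i%:Z
       + \sum_(1 <= i < n.+1) e ^+ i * nacf D i%:Z = 0.
  rewrite -!big_split /= big_nat_cond big1 // => i /andP[/andP[i_gt0 _] _].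
  by rewrite -!mulrDr sum0 ?mulr0.
lia.
Qed.

(** * Normal sequences *)

(** As n is even, the last entries add e^n = 1 to X(e) in A(e) and subtract it in
    B(e); the squares of X(e) + 1 and X(e) - 1 add up to 2 X(e)^2 + 2. *)
Lemma normal_sequences_values (n : nat) (A B C D : seq int) (e : int) :
  e ^+ 2 = 1 -> ~~ odd n -> normal_sequences n A B C D ->
  2 * value_at e n A ^+ 2 + value_at e n.+1 C ^+ 2 + value_at e n.+1 D ^+ 2
    = 4 * n%:Z.
Proof.
move=> e2 n_even [baseABCD eqBA lastA lastB].
have en : e ^+ n = 1.
  by rewrite -(odd_double_half n) (negbTE n_even) add0n -mul2n exprM e2 expr1n.
have valA : value_at e n.+1 A = value_at e n A + 1.
  by rewrite /value_at big_ord_recr /= -entryS lastA en mul1r.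
have valB : value_at e n.+1 B = value_at e n A - 1.
  rewrite /value_at big_ord_recr /= -[nth 0 B n]entryS lastB en mul1r.
  congr (_ - 1); apply: eq_bigr => j _.
  by rewrite -!entryS eqBA //=.
have := base_sequences_values e2 baseABCD; rewrite valA valB => valE.
have -> : 4 * n%:Z = (4 * n%:Z + 2) - 2 by ring.
by rewrite -valE; ring.
Qed.

Lemma value_at_even_odd (e : int) (m : nat) (A : seq int) : e ^+ 2 = 1 ->
  value_at e m.*2 A
  = \sum_(j < m) nth 0 A j.*2 + e * \sum_(j < m) nth 0 A j.*2.+1.
Proof.
move=> e2; elim: m => [|m IHm]; first by rewrite /value_at !big_ord0; ring.
have em : e ^+ m.*2 = 1 by rewrite -mul2n exprM e2 expr1n.
rewrite doubleS /value_at !big_ord_recr /= -/(value_at e m.*2 A) IHm.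
by rewrite exprS em; ring.
Qed.

Theorem theorem5p1 (k n : nat) (k_gt0 : (0 < k)%N) (n_def : n = (8 * k - 2)%N) :
  ~ exists A B C D : seq int, normal_sequences n A B C D.
Proof.
move=> [A [B [C [D normABCD]]]].
have n_even : ~~ odd n by lia.
have n_double : n = (4 * k - 1).*2 by lia.
have binA : binary_seq n.+1 A by case: normABCD => [[[]]].
have odd_sum (b : nat) : (b <= 1)%N ->
    exists q : int, \sum_(j < 4 * k - 1) nth 0 A (b + j.*2) = 2 * q + 1.
  move=> le_b1.
  have [|q ->] := @sum_signs_parity _ (index_enum 'I_(4 * k - 1))
    (fun j => nth 0 A (b + j.*2)).
    by move=> j; apply: (nth_binary binA); have := ltn_ord j; lia.
  rewrite -[index_enum _]enumT size_enum_ord.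
  by exists (q + 2 * k%:Z - 1); lia.
have [p sum_even] := odd_sum 0%N isT.
have [q sum_odd] := odd_sum 1%N isT.
(* If X(e) = 4 x, then C(e)^2 + D(e)^2 = 32 (k - x^2) - 8. *)
have not_div4 (e x : int) : e ^+ 2 = 1 -> value_at e n A <> 4 * x.
  move=> e2 valE; have := normal_sequences_values e2 n_even normABCD.
  rewrite valE => sumE.
  apply: (@sum_two_squares_neq (value_at e n.+1 C) (value_at e n.+1 D)
            (k%:Z - x ^+ 2)).
  have n_int : n%:Z = 8 * k%:Z - 2 by lia.
  have -> : 32 * (k%:Z - x ^+ 2) - 8 = 4 * n%:Z - 2 * (4 * x) ^+ 2.
    by rewrite n_int; ring.
  by rewrite -sumE; ring.
have value (e : int) : e ^+ 2 = 1 ->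
    value_at e n A = 2 * p + 1 + e * (2 * q + 1).
  by move=> e2; rewrite n_double value_at_even_odd // sum_even sum_odd.
(* X(1) = 2 (p + q + 1) and X(-1) = 2 (p - q), whose halves have opposite
   parities. *)
have [h [pqE|pqE]] : exists h : int, p - q = 2 * h \/ p + q + 1 = 2 * h.
  have [?|?] : ((p - q) %% 2)%Z = 0 \/ ((p + q + 1) %% 2)%Z = 0 by lia.
  - by exists ((p - q) %/ 2)%Z; lia.
  - by exists ((p + q + 1) %/ 2)%Z; lia.
- by apply: (not_div4 (-1) h) => //; rewrite value //; lia.
- by apply: (not_div4 1 h) => //; rewrite value //; lia.
Qed.
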